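(* Let $N^{+}(s)$ be the number of eigenvalues, counted with multiplicity, in $(0,s]$ of the operator $L_2=-\frac{\partial^2}{\partial t^2}-\Delta_x^2$ on $S^1\times S^2$; that is, $$N^{+}(s)=\sum_{\substack{j\in\mathbb{Z},\ k\in\mathbb{Z}_{\ge 0}\\ 0<j^2-(k(k+1))^2\le s}}(2k+1).$$ Then $$N^{+}(s)=\frac{1}{2}s\log s+\left(\gamma-\frac{1}{2}\right)s+R_{N^{+}}(s),\qquad R_{N^{+}}(s)=O(s^{3/4})\quad\text{as } s\to\infty,$$ where $\gamma$ denotes Euler's constant.
   Context: $S^1=\mathbb{R}/2\pi\mathbb{Z}$, $S^2$ is the standard unit sphere, and $\Delta_x$ is the Laplacian on $S^2$. The eigenfunctions of $L_2$ are $e^{ijt}Y_k(x)$ with $j\in\mathbb{Z}$ and $Y_k$ a spherical harmonic of degree $k\ge 0$; the eigenvalue is $j^2-(k(k+1))^2$, and for each pair $(j,k)$ the corresponding space has dimension $2k+1$. *)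

(* Defs.v *)
From HB Require Import structures.
From mathcomp Require Import all_boot all_order all_algebra.
From mathcomp Require Import all_classical all_reals all_analysis.
From mathcomp Require Import zify.

Set Implicit Arguments.
Unset Strict Implicit.
Unset Printing Implicit Defensive.

Import Order.TTheory GRing.Theory Num.Theory.
Import numFieldNormedType.Exports.
Local Open Scope classical_set_scope.
Local Open Scope ring_scope.

(* The eigenvalue of - d^2/dt^2 - Delta_x^2 on e^{ijt} Y_k(x), where Y_k is a
   spherical harmonic of degree k: - d^2/dt^2 contributes j^2 and Delta_x has
   eigenvalue - k(k+1) on Y_k. *)
Definition eigenvalue (j : int) (k : nat) : int :=
  j ^+ 2 - (k%:Z * (k%:Z + 1)) ^+ 2.

(* The dimension of the space spanned by the e^{ijt} Y_k for fixed (j, k). *)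
Definition multiplicity (k : nat) : nat := (2 * k + 1)%N.

Definition eigen_index (R : realType) (s : R) : set (int * nat) :=
  [set jk | 0 < eigenvalue jk.1 jk.2 /\ (eigenvalue jk.1 jk.2)%:~R <= s].

Definition Nplus (R : realType) (s : R) : nat :=
  \sum_(jk \in eigen_index s) multiplicity jk.2.

Definition euler_gamma (R : realType) : R :=
  limn (fun n : nat => series harmonic n - ln (n%:R : R)).

(* The Landau notations of landau.v look up a canonical [filter_on], which the
   library does not declare for the neighborhoods of +oo. *)
Canonical pinfty_filter_on (R : numFieldType) : filter_on R :=
  FilterType (pinfty_nbhs R) _.

(* The sum over [\in] is 0 by convention when infinitely many terms are
   nonzero; the next lemma shows that this never happens in [Nplus]. *)
Lemma eigen_index_finite (R : realType) (s : R) : finite_set (eigen_index s).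
Proof.
have [m sm] : exists m : nat, s <= m%:R.
  by exists (Num.truncn `|s|).+1; apply/ltW/(le_lt_trans (ler_norm s))/truncnS_gt.
apply: (@sub_finite_set _ _
  (((fun n : nat => n%:Z - m%:Z) @` `I_(2 * m).+1) `*` `I_m.+1)).
  move=> [j k] /= [] e0 /le_trans/(_ sm).
  rewrite -[m%:R]/(m%:~R) ler_int => em.
  move: e0 em; rewrite /eigenvalue /= => e0 em.
  have [jm km] : (`|j|%N <= m)%N /\ (k <= m)%N.
    have jj : j ^+ 2 = `|j|%N%:Z ^+ 2 by rewrite abszE real_normK// num_real.
    move: e0 em; rewrite jj; move: `|j|%N => a.
    have -> : k%:Z * (k%:Z + 1) = (k * k.+1)%N%:Z by rewrite PoszM -addn1 PoszD.
    have : (k <= k * k.+1)%N by rewrite leq_pmulr.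
    move: (k * k.+1)%N => M kM; rewrite subr_sqr => e0 em.
    by have Ma : (M < a)%N; nia.
  split => /=; last by rewrite /=; lia.
  exists (absz (j + m%:Z)) => /=; lia.
apply: finite_setX; last exact: finite_II.
by apply: finite_image; exact: finite_II.
Qed.

Lemma euler_gamma_is_cvg (R : realType) :
  cvgn (fun n : nat => series harmonic n - ln (n%:R : R)).
Proof.
have st (n : nat) : ln (n.+2%:R : R) - ln n.+1%:R <= n.+1%:R^-1.
  rewrite -ln_div ?posrE//.
  have -> : n.+2%:R / n.+1%:R = 1 + n.+1%:R^-1 :> R.
    by rewrite -[in LHS]natr1 mulrDl divff// mul1r.
  by apply: le_ln1Dx; rewrite (lt_trans (ltrN10 _))// invr_gt0.
have st' (n : nat) : n.+2%:R^-1 <= ln (n.+2%:R : R) - ln n.+1%:R.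
  rewrite -[leRHS]opprB lerNr -ln_div ?posrE//.
  have -> : n.+1%:R / n.+2%:R = 1 + - n.+2%:R^-1 :> R.
    by rewrite -[X in X / _ = _](addrK 1) natr1 mulrBl divff// mul1r.
  by apply: le_ln1Dx; rewrite ltrN2 invf_lt1// ltr1n.
suff : cvgn (fun n : nat => series harmonic n.+1 - ln (n.+1%:R : R)).
  move=> /cvg_ex[l ul]; apply/cvg_ex; exists l.
  by rewrite -(cvg_shiftS (fun n : nat => series harmonic n - ln (n%:R : R))).
apply: nonincreasing_is_cvgn.
  apply/nonincreasing_seqP => n.
  rewrite (seriesSr _ n.+1) lerBlDr -addrA lerD2l [harmonic _]/=.
  by rewrite addrC; exact: st'.
exists 0 => _ [n _ <-] /=.
rewrite subr_ge0 (@le_trans _ _ (ln n.+2%:R))//.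
  by rewrite ler_ln ?posrE// ler_nat.
elim: n => [|n ih].
  by have := st 0; rewrite ln1 subr0 seriesS /series/= big_geq// addr0.
rewrite seriesS -lerBlDr (le_trans _ (st n.+1))// lerB//.
Qed.

(* Main.v *)
Require Import Defs.
From mathcomp Require Import all_boot all_order all_algebra.
From mathcomp Require Import all_classical all_reals all_analysis.
From mathcomp Require Import zify ring lra.

(** The difference of squares factors the problem into a divisor-type sum.  Put
    [m = k(k+1)].  An eigenvalue [j^2 - m^2] is positive exactly when
    [|j| = m + d] with [d >= 1], and then it equals [d^2 + 2dm].  So it is at
    most [s] when [d^2 <= s] and [m <= x_d := (s - d^2) / (2d)].

    For fixed [d] the admissible [k] form an initial segment [0, ..., K_d - 1],
    where [K_d] counts the pronic numbers [k(k+1)] up to [x_d], and the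
    multiplicities [2k+1] add up to the perfect square [K_d ^ 2].  Both signs
    of [j] contribute, so [N^+(s)] is twice the sum of [K_d ^ 2] over
    [1 <= d <= sqrt s] ([NplusE]).  Since
    [(K_d - 1) K_d <= x_d < K_d (K_d + 1)], [K_d ^ 2] differs from [x_d] by at
    most [K_d <= 1 + sqrt x_d].  Replacing
    [2 K_d ^ 2] by [2 x_d = s/d - d] therefore costs in total
    [O(sum of sqrt (s/d) over d <= sqrt s) = O(sqrt s * s^(1/4))], which is
    where the exponent 3/4 comes from ([Nplus_near_divisor_sum]).

    The sum of [s/d - d] over [d <= sqrt s] is [s] times a harmonic sum of
    length about [sqrt s], that is [s (ln s / 2 + gamma) + O(sqrt s)], minus
    [s/2 + O(sqrt s)] ([divisor_sum_asymptotic]). *)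

Import Order.TTheory GRing.Theory Num.Theory.
Import numFieldNormedType.Exports.
Local Open Scope classical_set_scope.
Local Open Scope ring_scope.

(** * Counting pronic numbers *)

(** The number of [k] with [k(k+1) <= x]: completing the square turns this
    condition into [k + 1/2 <= sqrt (x + 1/4)]. *)
Definition pronic_count (R : realType) (x : R) : nat :=
  Num.truncn (2^-1 + Num.sqrt (x + 4^-1)).

Lemma ltn_pronic_count (R : realType) (x : R) (k : nat) : 0 <= x ->
  (k < pronic_count R x)%N = ((k * k.+1)%:R <= x).
Proof.
move=> x0; rewrite /pronic_count truncn_gt_nat -natr1 natrM -natr1.
have k0 : 0 <= k%:R :> R by [].
have -> : (k%:R + 1 <= 2^-1 + Num.sqrt (x + 4^-1)) =
          (k%:R + 2^-1 <= Num.sqrt (x + 4^-1)) :> bool.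
  by apply/idP/idP; lra.
rewrite -[k%:R + 2^-1]ger0_norm; last by lra.
rewrite -sqrtr_sqr ler_sqrt; last by lra.
by apply/idP/idP; nra.
Qed.

Lemma pronic_count_le_sqrt (R : realType) (x : R) : 0 <= x ->
  (pronic_count R x)%:R <= 1 + Num.sqrt x.
Proof.
move=> x0; case K : (pronic_count R x) => [|k].
  by rewrite addr_ge0 ?sqrtr_ge0.
have : (k < pronic_count R x)%N by rewrite K.
rewrite ltn_pronic_count// natrM -natr1 => kx.
rewrite addrC lerD2l -[k%:R]ger0_norm// -sqrtr_sqr ler_sqrt//.
by apply: le_trans kx; rewrite expr2; have : 0 <= k%:R :> R by []; nra.
Qed.

(** With [K] the count, [K-1] is the last admissible index and [K] the first
    inadmissible one, so [(K-1)K <= x < K(K+1)]: both bounds are within [K] of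
    [K^2]. *)
Lemma pronic_count_sqr (R : realType) (x : R) : 0 <= x ->
  `|(pronic_count R x)%:R ^+ 2 - x| <= (pronic_count R x)%:R.
Proof.
move=> x0; set K := pronic_count R x.
have xK : x < (K * K.+1)%:R.
  by rewrite ltNge -ltn_pronic_count// ltnn.
have Kx : (K * K.-1)%:R <= x.
  case E : K => [|k]; first by rewrite mul0n.
  by rewrite mulnC -ltn_pronic_count// -/K E.
rewrite ler_norml; apply/andP; split.
  by move: xK; rewrite natrM -natr1; lra.
move: Kx; case: (K) => [|k]; first by rewrite mul0n expr0n/= ; lra.
by rewrite natrM -natr1 /=; lra.
Qed.

(** * The eigenvalue count as a sum of squares *)

Lemma sum_multiplicity (n : nat) :
  (\sum_(0 <= k < n) multiplicity k = n ^ 2)%N.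
Proof.
elim: n => [|n IHn]; first by rewrite big_geq.
by rewrite big_nat_recr//= IHn /multiplicity; lia.
Qed.

(** The parameter [e] is the sign of [j]; with [m = k(k+1)] this is
    [(d + m)^2 - m^2 = d^2 + 2dm]. *)
Lemma eigenvalue_shift (d k : nat) (e : int) : e ^+ 2 = 1 ->
  Defs.eigenvalue (e * (d + k * k.+1)%N%:Z) k
    = (d ^ 2 + 2 * d * (k * k.+1))%N%:Z.
Proof. by move=> e1; rewrite /Defs.eigenvalue exprMn e1; lia. Qed.

Lemma eigenvalue_le (R : realType) (s : R) (d k : nat) (e : int) :
  (0 < d)%N -> e ^+ 2 = 1 ->
  ((Defs.eigenvalue (e * (d + k * k.+1)%N%:Z) k)%:~R <= s) =
  ((k * k.+1)%:R <= (s - d%:R ^+ 2) / (2 * d%:R)).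
Proof.
move=> d0 e1; rewrite eigenvalue_shift// -pmulrn.
rewrite ler_pdivlMr ?mulr_gt0 ?ltr0n//.
rewrite natrD natrX [(2 * d * _)%:R]natrM natrM.
by apply/idP/idP; nra.
Qed.

(** The part of the index set where [j] has sign [e], listed by the gap
    [d = |j| - k(k+1)] and by [k]. *)
Definition eigen_seq (R : realType) (s : R) (e : int) : seq (int * nat) :=
  [seq (e * (d + k * k.+1)%N%:Z, k)
    | d <- index_iota 1 (Num.truncn (Num.sqrt s)).+1,
      k <- index_iota 0 (pronic_count R ((s - d%:R ^+ 2) / (2 * d%:R)))].

Lemma le_truncn_sqrt (R : realType) (s : R) (d : nat) : 0 <= s ->
  (d <= Num.truncn (Num.sqrt s))%N = (d%:R ^+ 2 <= s).
Proof.
move=> s0; rewrite truncn_ge_nat ?sqrtr_ge0//.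
by rewrite -[d%:R in LHS]ger0_norm// -sqrtr_sqr ler_sqrt.
Qed.

(** Solving [d^2 + 2d k(k+1) <= s] for [k(k+1)] gives the range of [k]; that
    [d <= sqrt s] then follows from [0 <= k(k+1) <= (s - d^2) / (2d)]. *)
Lemma eigenvalue_le_rangeP (R : realType) (s : R) (e : int) (d k : nat) :
  0 <= s -> e ^+ 2 = 1 -> (0 < d)%N ->
  (Defs.eigenvalue (e * (d + k * k.+1)%N%:Z) k)%:~R <= s <->
  [/\ d \in index_iota 1 (Num.truncn (Num.sqrt s)).+1 &
    k \in index_iota 0 (pronic_count R ((s - d%:R ^+ 2) / (2 * d%:R)))].
Proof.
move=> s0 e1 d0; rewrite eigenvalue_le// !mem_index_iota /= d0 ltnS /=.
rewrite le_truncn_sqrt//.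
have dd : 0 < 2 * d%:R :> R by rewrite mulr_gt0 ?ltr0n.
split=> [kd|[ds]]; last by rewrite ltn_pronic_count// divr_ge0 ?subr_ge0// ltW.
have xd : 0 <= (s - d%:R ^+ 2) / (2 * d%:R) by exact: le_trans kd.
rewrite ltn_pronic_count// -subr_ge0; split=> //.
by move: xd; rewrite pmulr_lge0// invr_gt0.
Qed.

Lemma eigen_seq_uniq (R : realType) (s : R) (e : int) : e ^+ 2 = 1 ->
  uniq (eigen_seq R s e).
Proof.
move=> e1; have e0 : e != 0 by apply: contra_eq_neq e1 => ->.
apply: allpairs_uniq_dep; first exact: iota_uniq.
- by move=> d _; exact: iota_uniq.
- move=> [d k] [d' k'] _ _ /= [+ kk]; subst k' => /(mulfI e0) dd.
  by have -> : d = d' by lia.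
Qed.

Lemma eigen_indexE (R : realType) (s : R) : 0 <= s ->
  eigen_index s = [set` eigen_seq R s 1 ++ eigen_seq R s (-1)].
Proof.
move=> s0; apply/seteqP; split=> -[j k] /=; rewrite mem_cat.
- move=> [lam0 lams].
  have [e [d [e1 d0 jE]]] : exists e : int, exists d : nat,
      [/\ e = 1 \/ e = -1, (0 < d)%N & j = e * (d + k * k.+1)%N%:Z].
    move: lam0; rewrite /Defs.eigenvalue /= => lam0.
    exists (if (0 <= j)%R then 1 else -1), (`|j| - k * k.+1)%N.
    by case: ifP => j0; split; [left| nia | nia | right | nia | nia ].
  have ee : e ^+ 2 = 1 by case: e1 => ->.
  move: lams; rewrite jE => /eigenvalue_le_rangeP -/(_ s0 ee d0)[dD kK].
  apply/orP; case: e1 => eE; [left|right];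
    by apply/allpairsPdep; exists d, k; split; rewrite // eE.
- wlog suff H : / forall e : int, e ^+ 2 = 1 -> (j, k) \in eigen_seq R s e ->
      (0 < Defs.eigenvalue j k) /\ (Defs.eigenvalue j k)%:~R <= s.
    by move=> /orP[]; apply: H.
  move=> e ee /allpairsPdep[d [k' [dD kK [-> kk]]]]; subst k'.
  have d0 : (0 < d)%N by move: dD; rewrite mem_index_iota => /andP[].
  split; last exact/eigenvalue_le_rangeP.
  by rewrite eigenvalue_shift//; nia.
Qed.

(** The two signs of [j] give disjoint lists because [|j| >= d >= 1], whence the
    factor 2. *)
Lemma NplusE (R : realType) (s : R) : 0 <= s ->
  Nplus s = (2 * \sum_(1 <= d < (Num.truncn (Num.sqrt s)).+1)
     pronic_count R ((s - d%:R ^+ 2) / (2 * d%:R)) ^ 2)%N.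
Proof.
move=> s0; rewrite /Nplus eigen_indexE// -fsbig_seq.
  rewrite big_cat/= mul2n -addnn.
  by congr addn; rewrite big_allpairs_dep; apply: eq_bigr => d _;
    rewrite -sum_multiplicity.
rewrite cat_uniq !eigen_seq_uniq// andbT /=; apply/hasPn => -[j k].
move=> /allpairsPdep[d [k1 [dD _ [jE _]]]]; apply/negP.
move=> /allpairsPdep[d' [k2 [d'D _ [jE' _]]]].
by move: dD d'D; rewrite !mem_index_iota; nia.
Qed.

(** * Explicit bounds for the harmonic sum *)

Lemma ln_succ_le (R : realType) (n : nat) :
  ln (n.+2%:R : R) - ln n.+1%:R <= n.+1%:R^-1.
Proof.
rewrite -ln_div ?posrE//.
have -> : n.+2%:R / n.+1%:R = 1 + n.+1%:R^-1 :> R.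
  by rewrite -[in LHS]natr1 mulrDl divff// mul1r.
by apply: le_ln1Dx; rewrite (lt_trans (ltrN10 _))// invr_gt0.
Qed.

Lemma ln_succ_ge (R : realType) (n : nat) :
  n.+2%:R^-1 <= ln (n.+2%:R : R) - ln n.+1%:R.
Proof.
rewrite -[leRHS]opprB lerNr -ln_div ?posrE//.
have -> : n.+1%:R / n.+2%:R = 1 + - n.+2%:R^-1 :> R.
  by rewrite -[X in X / _ = _](addrK 1) natr1 mulrBl divff// mul1r.
by apply: le_ln1Dx; rewrite ltrN2 invf_lt1// ltr1n.
Qed.

Lemma series_harmonicS (R : realType) (n : nat) :
  series harmonic n.+1 = series harmonic n + n.+1%:R^-1 :> R.
Proof. by rewrite /series /= big_nat_recr. Qed.

Lemma cvg_harmonic_ln (R : realType) :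
  (fun n : nat => series harmonic n.+1 - ln (n.+1%:R : R)) @ \oo
    --> euler_gamma R.
Proof.
by rewrite (cvg_shiftS (fun n : nat => series harmonic n - ln (n%:R : R)));
  exact: euler_gamma_is_cvg.
Qed.

(** The sequence [H_n - ln n] decreases to its limit, while [H_n - ln (n+1)]
    increases to the same limit; together they enclose [gamma] in an interval of
    length [O(1/n)]. *)
Lemma euler_gamma_le (R : realType) (n : nat) :
  euler_gamma R <= series harmonic n.+1 - ln (n.+1%:R : R).
Proof.
have g := cvg_harmonic_ln R.
rewrite -(cvg_lim (@Rhausdorff R) g).
apply: (nonincreasing_cvgn_ge _ (cvgP _ g) n).
apply/nonincreasing_seqP => m /=.
by rewrite series_harmonicS -addrA lerD2l lerBlDr addrC; exact: ln_succ_ge.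
Qed.

Lemma euler_gamma_ge (R : realType) (n : nat) :
  series harmonic n.+1 - ln (n.+2%:R : R) <= euler_gamma R.
Proof.
have g : (fun n : nat => series harmonic n.+1 - ln (n.+2%:R : R)) @ \oo
    --> euler_gamma R.
  have := cvg_harmonic_ln R.
  rewrite -(cvg_shiftS
    (fun n : nat => series harmonic n.+1 - ln (n.+1%:R : R))).
  have := @cvg_harmonic R.
  rewrite -(cvg_shiftS (fun n : nat => harmonic n : R)) => h0 /= g1.
  have -> : (fun n : nat => series harmonic n.+1 - ln (n.+2%:R : R)) =
      (fun n : nat => series harmonic n.+2 - ln n.+2%:R - harmonic n.+1).
    by apply/funext => m; rewrite (series_harmonicS _ m.+1) addrAC addrK.
  have := cvgB g1 h0; rewrite subr0 => H; exact: H.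
rewrite -(cvg_lim (@Rhausdorff R) g).
apply: (nondecreasing_cvgn_le _ (cvgP _ g) n).
apply/nondecreasing_seqP => m /=.
rewrite (series_harmonicS _ m.+1) -addrA lerD2l lerBrDl.
exact: ln_succ_le.
Qed.

Lemma sum_invE (R : realType) (n : nat) :
  \sum_(1 <= d < n.+1) (d%:R : R)^-1 = series harmonic n.
Proof. by rewrite /series /= big_add1. Qed.

(** As [r] lies between consecutive integers [n] and [n+1], [ln r] lies between
    the logarithms used in the enclosure of [gamma], whose width is at most
    [1/n <= 2/r]. *)
Lemma harmonic_ln_gamma (R : realType) (r : R) : 1 <= r ->
  `|\sum_(1 <= d < (Num.truncn r).+1) (d%:R)^-1 - ln r - euler_gamma R|
    <= 2 / r.
Proof.
move=> r1; have r0 : 0 < r by lra.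
rewrite sum_invE.
have := truncn_itv (ltW r0).
have : (0 < Num.truncn r)%N by rewrite truncn_gt0.
case: (Num.truncn r) => // n _ /andP[nr rn].
have lnr : ln (n.+1%:R : R) <= ln r by rewrite ler_ln ?posrE.
have lrn : ln r <= ln (n.+2%:R : R) by rewrite ler_ln ?posrE// ltW.
have := euler_gamma_le R n; have := euler_gamma_ge R n.
have n2 : n.+1%:R^-1 <= 2 / r.
  rewrite ler_pdivlMr// mulrC ler_pdivrMr//.
  have n1 : 1 <= n.+1%:R :> R by rewrite ler1n.
  by move: rn; rewrite -[n.+2%:R]natr1; lra.
have /le_trans/(_ n2) := ln_succ_le R n.
move: lnr lrn; move: (ln n.+1%:R) (ln n.+2%:R) (ln r) (series _ _) (2 / r).
by move=> *; rewrite ler_norml; apply/andP; split; lra.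
Qed.

(** Telescoping: [1 / sqrt (n+1) <= 2 (sqrt (n+1) - sqrt n)]. *)
Lemma sum_inv_sqrt_le (R : realType) (n : nat) :
  \sum_(1 <= d < n.+1) (Num.sqrt d%:R)^-1 <= 2 * Num.sqrt n%:R :> R.
Proof.
elim: n => [|n IHn]; first by rewrite big_geq// sqrtr0 mulr0.
rewrite big_nat_recr//=; apply: le_trans (lerD IHn (lexx _)) _.
set b := Num.sqrt n.+1%:R; set a := Num.sqrt n%:R.
have b0 : 0 < b by rewrite sqrtr_gt0.
have a0 : 0 <= a by exact: sqrtr_ge0.
have bb : b ^+ 2 = a ^+ 2 + 1 by rewrite !sqr_sqrtr// natr1.
rewrite -lerBrDl -(ler_pM2r b0) mulVf ?gt_eqF//.
by have := sqr_ge0 (a - b); nra.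
Qed.

Lemma sum_natr (R : realType) (n : nat) :
  \sum_(1 <= d < n.+1) d%:R = n%:R * (n%:R + 1) / 2 :> R.
Proof.
elim: n => [|n IHn]; first by rewrite big_geq// !mul0r.
by rewrite big_nat_recr//= IHn -natr1; field.
Qed.

Lemma powR34 (R : realType) (s : R) : 0 <= s ->
  s `^ (3 / 4) = Num.sqrt s * Num.sqrt (Num.sqrt s).
Proof.
move=> s0; have -> : 3 / 4 = 2^-1 + 2^-1 * 2^-1 :> R by field.
rewrite powRD; last by apply/implyP => /eqP; lra.
by rewrite powRrM !powR12_sqrt ?powR_ge0 ?sqrtr_ge0.
Qed.

(** * The asymptotic formula *)

(** The terms differ by at most [2 K_d <= 2 + 2 sqrt (s/d)]; the constant part
    sums to at most [2 sqrt s], the other to at most [4 sqrt s * s^(1/4)]. *)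
Lemma Nplus_near_divisor_sum (R : realType) (s : R) : 1 <= s ->
  `|(Nplus s)%:R -
    \sum_(1 <= d < (Num.truncn (Num.sqrt s)).+1) (s / d%:R - d%:R)|
  <= 6 * (Num.sqrt s * Num.sqrt (Num.sqrt s)).
Proof.
move=> s1; have s0 : 0 <= s by lra.
rewrite NplusE// natrM natr_sum mulr_sumr -sumrB.
set r := Num.sqrt s; set q := Num.sqrt r; set D := Num.truncn r.
have r1 : 1 <= r by rewrite -sqrtr1 ler_sqrt.
have q1 : 1 <= q by rewrite -sqrtr1 ler_sqrt//; lra.
have Dr : D%:R <= r by rewrite truncn_le; lra.
apply: le_trans (ler_norm_sum _ _ _) _.
apply: (@le_trans _ _ (\sum_(1 <= d < D.+1) (2 + 2 * r * (Num.sqrt d%:R)^-1))).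
  rewrite !big_nat; apply: ler_sum => d /andP[d0 dD].
  have d0' : 0 < d%:R :> R by rewrite ltr0n.
  set x := (s - d%:R ^+ 2) / (2 * d%:R).
  have ds : d%:R ^+ 2 <= s by rewrite -le_truncn_sqrt.
  have x0 : 0 <= x by rewrite divr_ge0 ?subr_ge0//; lra.
  have -> : s / d%:R - d%:R = 2 * x by rewrite /x; field; rewrite gt_eqF.
  rewrite natrX -mulrBr normrM ger0_norm//.
  have xs : Num.sqrt x <= r * (Num.sqrt d%:R)^-1.
    rewrite -sqrtrV ?ler0n// -sqrtrM// ler_sqrt ?divr_ge0 ?ler0n//.
    rewrite /x ler_pdivrMr ?mulr_gt0//.
    have -> : s / d%:R * (2 * d%:R) = 2 * s by field; rewrite gt_eqF.
    by have := sqr_ge0 (d%:R : R); lra.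
  have := pronic_count_sqr R x x0; have := pronic_count_le_sqrt R x x0.
  move: xs; move: (Num.sqrt d%:R)^-1 (Num.sqrt x) (pronic_count R x)%:R.
  move=> i y K.
  by move: `|_| => *; lra.
rewrite big_split/= -mulr_sumr sumr_const_nat subn1 /=.
have := sum_inv_sqrt_le R D; move: (\sum_(_ <= _ < _) _) => S SD.
have Dq : Num.sqrt D%:R <= q by rewrite ler_sqrt//; lra.
have {}SD : S <= 2 * q by lra.
rewrite -[2 *+ D]mulr_natr.
by nra.
Qed.

(** With [r = sqrt s] and [D] its integer part, the harmonic part is off by at
    most [s * 2/r = 2r], and [D(D+1)/2] is within [r] of [s/2]. *)
Lemma divisor_sum_asymptotic (R : realType) (s : R) : 1 <= s ->
  `|\sum_(1 <= d < (Num.truncn (Num.sqrt s)).+1) (s / d%:R - d%:R)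
    - (2^-1 * s * ln s + (euler_gamma R - 2^-1) * s)| <= 3 * Num.sqrt s.
Proof.
move=> s1; set r := Num.sqrt s.
have r1 : 1 <= r by rewrite -sqrtr1 ler_sqrt//; lra.
have rr : r ^+ 2 = s by rewrite sqr_sqrtr; lra.
have := harmonic_ln_gamma R r r1.
have /andP[Dr rD] : (Num.truncn r)%:R <= r < (Num.truncn r)%:R + 1.
  by rewrite natr1 truncn_itv; lra.
rewrite sumrB -mulr_sumr sum_natr -rr lnXn; last by lra.
move: (\sum_(_ <= _ < _) _) => H.
move: (ln r) (euler_gamma R) (Num.truncn r)%:R Dr rD => l g D Dr rD.
rewrite -[l *+ 2]mulr_natr => Hlg.
have {}Hlg : `|r ^+ 2 * (H - l - g)| <= 2 * r.
  rewrite normrM ger0_norm ?sqr_ge0// expr2 -mulrA [2 * r]mulrC.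
  rewrite ler_pM2l; last by lra.
  by rewrite mulrC -ler_pdivlMr; lra.
have DD : `|D * (D + 1) / 2 - r ^+ 2 / 2| <= r.
  by rewrite ler_norml; apply/andP; split; nra.
have -> : r ^+ 2 * H - D * (D + 1) / 2 -
    (2^-1 * r ^+ 2 * (l * 2) + (g - 2^-1) * r ^+ 2) =
    r ^+ 2 * (H - l - g) - (D * (D + 1) / 2 - r ^+ 2 / 2) by field.
by apply: le_trans (ler_normB _ _) _; lra.
Qed.

Theorem theorem6p6 (R : realType) :
  exists RN : R -> R,
    (forall s : R, 0 < s ->
       (Nplus s)%:R = 2^-1 * s * ln s + (euler_gamma R - 2^-1) * s + RN s) /\
    RN =O_+oo (fun s : R => s `^ (3 / 4)).
Proof.
exists (fun s => (Nplus s)%:R -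
  (2^-1 * s * ln s + (euler_gamma R - 2^-1) * s)); split.
  by move=> s _; rewrite addrC subrK.
(* 9 = 6 + 3: the constants of the two estimates, as [sqrt s <= s^(3/4)]. *)
apply/eqO_exP; exists 9 => //.
near=> s; have s1 : 1 <= s by near: s; exact: nbhs_pinfty_ge.
rewrite (ger0_norm (powR_ge0 s _)) powR34; last by lra.
have r1 : 1 <= Num.sqrt s by rewrite -[leLHS]sqrtr1 ler_sqrt//; lra.
have q1 : 1 <= Num.sqrt (Num.sqrt s) by rewrite -[leLHS]sqrtr1 ler_sqrt//; lra.
pose S : R := \sum_(1 <= d < (Num.truncn (Num.sqrt s)).+1) (s / d%:R - d%:R).
apply: le_trans (ler_distD S _ _) _.
apply: le_trans (lerD (Nplus_near_divisor_sum R s s1)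
  (divisor_sum_asymptotic R s s1)) _.
by nra.
Unshelve. all: by end_near. Qed.
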